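(* Let $a<b$ be real numbers, let $g:\mathbb{R}\to\mathbb{R}$ be non-decreasing and left continuous, and let $F\subset \operatorname{BC}_g([a,b],\mathbb{F})$ be $g$-equicontinuous. Then the following statements are equivalent: 1. $F$ is uniformly $g$-equicontinuous. 2. For every $t\in[a,b)\cap D_g$ and every $f\in F$ the limit $\lim_{s\to t^+}f(s)$ exists in $\mathbb{F}$, and, for each such $t$, this limit is uniform on $F$ (i.e. uniform with respect to $f\in F$).
   Context: $\mathbb{F}$ is $\mathbb{R}$ or $\mathbb{C}$. $D_g=\{t\in\mathbb{R}: g(t^+)-g(t)>0\}$, where $g(t^+)$ is the right-hand limit of $g$ at $t$. A function $f:[a,b]\to\mathbb{F}$ is $g$-continuous at $t\in[a,b]$ if for every $\varepsilon>0$ there is $\delta>0$ such that $|f(t)-f(s)|<\varepsilon$ for all $s\in[a,b]$ with $|g(t)-g(s)|<\delta$; $\operatorname{BC}_g([a,b],\mathbb{F})$ is the set of bounded functions that are $g$-continuous at every point of $[a,b]$. A set $S\subset\operatorname{BC}_g([a,b],\mathbb{F})$ is $g$-equicontinuous if for every $\varepsilon>0$ and $t\in[a,b]$ there is $\delta>0$ such that $|f(t)-f(s)|<\varepsilon$ for every $f\in S$ and every $s\in[a,b]$ with $|g(t)-g(s)|<\delta$. It is uniformly $g$-equicontinuous if for every $\varepsilon>0$ there is $\delta>0$ such that $|f(t)-f(s)|<\varepsilon$ for every $f\in S$ and all $s,t\in[a,b]$ with $|g(t)-g(s)|<\delta$. *)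

(* Defs.v *)
From mathcomp Require Import all_boot all_order all_algebra.
From mathcomp Require Import complex.
From mathcomp Require Import all_classical all_reals all_analysis.

Set Implicit Arguments.
Unset Strict Implicit.
Unset Printing Implicit Defensive.

Import Order.TTheory GRing.Theory Num.Theory.
Import numFieldNormedType.Exports.

Local Open Scope classical_set_scope.
Local Open Scope ring_scope.

Variant scalars := RealScalars | ComplexScalars.

Definition scalar_field (R : realType) (k : scalars) : numFieldType :=
  match k with
  | RealScalars => R
  | ComplexScalars => R[i]%C
  end.

(* A function [a, b] -> K is represented by a total function R -> K, of which
   only the values on [a, b] are ever constrained.

   In the definitions below, an error e in K with 0 < e is a positive real
   number: for K = R[i], 0 < e holds iff 'Im e = 0 and 0 < 'Re e. *)

Definition discontinuities (R : realType) (g : R -> R) : set R :=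
  [set t | 0 < lim (g s @[s --> t^'+]) - g t].

Definition g_continuous_at (R : realType) (K : numFieldType) (a b : R)
    (g : R -> R) (f : R -> K) (t : R) : Prop :=
  forall e : K, 0 < e -> exists2 d : R, 0 < d &
    forall s : R, s \in `[a, b] -> `|g t - g s| < d -> `|f t - f s| < e.

Definition BC (R : realType) (K : numFieldType) (a b : R) (g : R -> R) :
    set (R -> K) :=
  [set f | [bounded f t | t in `[a, b]] /\
    forall t, t \in `[a, b] -> g_continuous_at a b g f t].

Definition g_equicontinuous (R : realType) (K : numFieldType) (a b : R)
    (g : R -> R) (F : set (R -> K)) : Prop :=
  forall (e : K) (t : R), 0 < e -> t \in `[a, b] -> exists2 d : R, 0 < d &
    forall (f : R -> K) (s : R), F f -> s \in `[a, b] ->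
      `|g t - g s| < d -> `|f t - f s| < e.

Definition uniformly_g_equicontinuous (R : realType) (K : numFieldType)
    (a b : R) (g : R -> R) (F : set (R -> K)) : Prop :=
  forall e : K, 0 < e -> exists2 d : R, 0 < d &
    forall (f : R -> K) (s t : R), F f -> s \in `[a, b] -> t \in `[a, b] ->
      `|g t - g s| < d -> `|f t - f s| < e.

Definition uniform_right_limit (R : realType) (K : numFieldType)
    (F : set (R -> K)) (t : R) : Prop :=
  forall e : K, 0 < e -> \forall s \near t^'+, forall f : R -> K, F f ->
    `|f s - lim (f u @[u --> t^'+])| < e.

(* Main.v *)
Require Import Defs.
From mathcomp Require Import all_boot all_order all_algebra.
From mathcomp Require Import complex.
From mathcomp Require Import all_classical all_reals all_analysis.
From mathcomp Require Import lra.

Import Order.TTheory GRing.Theory Num.Theory.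
Import numFieldNormedType.Exports.

Local Open Scope classical_set_scope.
Local Open Scope ring_scope.

(** The condition becomes local in the values of [g]: uniform equicontinuity
    follows, by a Lebesgue number on the compact [[g a, g b]], once every [y] in
    it has a neighbourhood [V] such that each [f] in [F] varies by less than [e]
    on the points sent into [V]. If [y = g t], this is equicontinuity at [t].
    Otherwise [g] jumps over [y] at some [t < b], the points sent close to [y]
    lie just to the right of [t], and the uniform right limit at [t] concludes.
    Conversely, since a monotone [g] has right limits, uniform equicontinuity
    gives a Cauchy condition at [t^+] that is uniform over [F]. *)

(** Completeness of [R]. Hypothesis and conclusion mention only order and norm, so that the real and
    complex cases have the same shape. *)
Lemma real_cauchy_cvg (R : realType) (T : Type) (G : set_system T)
    {FG : ProperFilter G} (f : T -> R) :
  (forall e : R, 0 < e -> exists x, \forall y \near G, `|x - f y| < e) ->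
  exists l : R, forall e : R, 0 < e -> \forall y \near G, `|l - f y| < e.
Proof.
move=> cauchyG; have /cauchy_cvg/cvg_ex [l fl] : cauchy (f @ G).
  apply: cauchy_exP => e /cauchyG[x xG]; exists x.
  by rewrite -ball_normE.
by exists l => e e0; have /cvgrPdist_lt := fl; apply.
Qed.

Lemma complex_norm_lt (R : rcfType) (z : R[i]) (e : R) :
  `|complex.Re z| < e / 2 -> `|complex.Im z| < e / 2 -> `|z| < e%:C%C.
Proof.
rewrite -2!ltcR => reze imze; rewrite [z]complexE.
apply: (le_lt_trans (ler_normD _ _)).
have i1 : `|'i%C : R[i]| = 1.
  by rewrite normc_def/= expr0n/= add0r expr1n sqrtr1.
rewrite normrM i1 mul1r.
have normRe (x : R) : `|x%:C%C| = `|x|%:C%C.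
  by rewrite normc_def/= expr0n/= addr0 sqrtr_sqr.
by rewrite !normRe [e]splitr rmorphD ltrD.
Qed.

Lemma normc_ge_Im (R : rcfType) (z : R[i]) : `|complex.Im z|%:C%C <= `|z|.
Proof.
by rewrite normc_def lecR -sqrtr_sqr ler_wsqrtr// lerDr sqr_ge0.
Qed.

(** Real and imaginary parts are bounded by the norm, so both are Cauchy in [R]; their limits
    assemble into the complex limit. *)
Lemma complex_cauchy_cvg (R : realType) (T : Type) (G : set_system T)
    {FG : ProperFilter G} (f : T -> R[i]) :
  (forall e : R[i], 0 < e -> exists x, \forall y \near G, `|x - f y| < e) ->
  exists l, forall e : R[i], 0 < e -> \forall y \near G, `|l - f y| < e.
Proof.
move=> cauchyG.
have [|p pG] := @real_cauchy_cvg R T G _ (fun y => complex.Re (f y)).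
  move=> e e0; have /cauchyG[x xG] : 0 < e%:C%C by rewrite ltcR.
  exists (complex.Re x); apply: filterS xG => y.
  by rewrite -ltcR -raddfB; apply: le_lt_trans; exact: normc_ge_Re.
have [|q qG] := @real_cauchy_cvg R T G _ (fun y => complex.Im (f y)).
  move=> e e0; have /cauchyG[x xG] : 0 < e%:C%C by rewrite ltcR.
  exists (complex.Im x); apply: filterS xG => y.
  by rewrite -ltcR -raddfB; apply: le_lt_trans; exact: normc_ge_Im.
exists (p +i* q)%C => e e0.
(* In [R[i]], [0 < e] forces [e] to be real. *)
have er : e = (complex.Re e)%:C%C by rewrite RRe_real// gtr0_real.
have re0 : 0 < complex.Re e / 2 by rewrite divr_gt0// -ltcR -er.
apply: filterS2 (pG _ re0) (qG _ re0) => y py qy.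
by rewrite er; apply: complex_norm_lt; rewrite raddfB.
Qed.

Lemma scalar_cauchy_cvg (R : realType) (k : scalars) (T : Type)
    (G : set_system T) {FG : ProperFilter G} (f : T -> scalar_field R k) :
  (forall e : scalar_field R k, 0 < e ->
    exists x, \forall y \near G, `|x - f y| < e) ->
  cvg (f @ G).
Proof.
move=> cauchyG.
suff [l lG] : exists l, forall e : scalar_field R k, 0 < e ->
    \forall y \near G, `|l - f y| < e.
  by apply/cvg_ex; exists l; apply/cvgrPdist_lt.
case: k f cauchyG => f; [exact: real_cauchy_cvg | exact: complex_cauchy_cvg].
Qed.

Lemma monotone_right_cvg (R : realType) (g : R -> R) (t : R) :
  {homo g : x y / x <= y} -> cvg (g s @[s --> t^'+]).
Proof.
move=> ndg; apply: nondecreasing_at_right_is_cvgr; near=> x.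
  by move=> u v _ _; exact: ndg.
exists (g t) => _ [u /= utx <-]; apply: ndg.
by move: utx; rewrite in_itv/= => /andP[/ltW].
Unshelve. all: by end_near. Qed.

Lemma uniformly_g_equicontinuous_right_limit (R : realType) (k : scalars)
    (a b t : R) (g : R -> R) (F : set (R -> scalar_field R k)) :
  {homo g : x y / x <= y} -> t \in `[a, b[ ->
  uniformly_g_equicontinuous a b g F ->
  (forall f, F f -> cvg (f s @[s --> t^'+])) /\ uniform_right_limit F t.
Proof.
move=> ndg; rewrite in_itv/= => /andP[at_ tb] ucF.
(* The set [A] does not depend on [f]: on it [g] stays within [d / 2] of its right limit at [t], so
   any two of its points have [g]-values less than [d] apart. *)
have cauchyF (e : scalar_field R k) : 0 < e ->
    exists2 A : set R, (\forall s \near t^'+, A s) &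
      forall f s u, F f -> A s -> A u -> `|f s - f u| < e.
  move=> /ucF[d d0 dF].
  have /cvg_ex[l gl] := monotone_right_cvg _ g t ndg.
  have d20 : 0 < d / 2 by rewrite divr_gt0.
  exists [set s | s \in `[a, b] /\ `|l - g s| < d / 2].
    near=> s; split.
      rewrite in_itv/=; apply/andP; split; near: s.
        by apply: filterS (nbhs_right_ge t) => s; exact: le_trans.
      exact: nbhs_right_le.
    by near: s; move/cvgrPdist_lt : gl; apply.
  move=> f s u Ff [sab ls] [uab lu]; apply: dF => //.
  rewrite [d]splitr; apply: le_lt_trans (ltrD ls lu).
  by rewrite (distrC l) ler_distD.
have cvgF (f : R -> scalar_field R k) : F f -> cvg (f s @[s --> t^'+]).
  move=> Ff; apply: scalar_cauchy_cvg => e /cauchyF[A tA AF].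
  have [s As] := @filter_ex _ _ (at_right_proper_filter t) _ tA.
  by exists (f s); apply: filterS tA => u Au; exact: AF.
split=> // e e0; have e20 : 0 < e / 2 by rewrite divr_gt0.
have [A tA AF] := cauchyF _ e20.
(* The intermediate point [u] below may depend on [f], since only [A] has to be common to all of
   [F]. *)
apply: filterS (tA) => s As f Ff.
have /cvg_ex[l fl] := cvgF f Ff; rewrite (cvg_lim _ fl)//.
have lG : \forall u \near t^'+, `|l - f u| < e / 2.
  by move/cvgrPdist_lt : fl; apply.
have [u [Au lu]] := @filter_ex _ _ (at_right_proper_filter t) _ (filterI tA lG).
rewrite [e]splitr; apply: le_lt_trans (ltrD (AF f s u Ff As Au) lu).
by rewrite (distrC l) ler_distD.
Unshelve. all: by end_near. Qed.

(* Left continuity makes sup {s | g s <= y} a point where g is still below y,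
   so g jumps over y there. *)
Lemma skipped_value_jump (R : realType) (a b : R) (g : R -> R) (y : R) :
  a < b -> {homo g : x y / x <= y} ->
  (forall t : R, g s @[s --> t^'-] --> g t) ->
  y \in `[g a, g b] -> (forall t, t \in `[a, b] -> g t != y) ->
  exists t, [/\ t \in `[a, b[, g t < y & forall s, t < s <= b -> y < g s].
Proof.
move=> ab ndg lcg; rewrite in_itv/= => /andP[gay ygb] gNy.
pose S := [set s | s \in `[a, b] /\ g s <= y].
have Sa : S a by split=> //; rewrite in_itv/= lexx ltW.
have ubS : ubound S b by move=> s [+ _]; rewrite in_itv/= => /andP[].
have supS : has_sup S by split; [exists a | exists b].
pose t := sup S.
have a_t : a <= t by apply: ub_le_sup => //; exists b.
have tb : t <= b by apply: ge_sup => //; exists a.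
have gty : g t <= y.
  (* If [y < g t], left continuity gives [s < t] with [y < g s], while the supremum gives [r] in [S]
     beyond [s] with [g r <= y], against monotonicity. *)
  rewrite leNgt; apply/negP => ygt.
  have : \forall s \near t^'-, s < t /\ y < g s.
    near=> s; split; first by near: s; exact: nbhs_left_lt.
    by near: s; exact: (cvgr_gt _ (lcg t)).
  move=> /(@filter_ex _ _ (at_left_proper_filter t)) [s [st ygs]].
  have ts0 : 0 < t - s by rewrite subr_gt0.
  have [r [_ gry]] := sup_adherent ts0 supS.
  rewrite opprB addrC subrK => /ltW/ndg sr.
  by move: ygs; rewrite ltNge (le_trans sr gry).
have gtNy : g t < y by rewrite lt_neqAle gty gNy// in_itv/= a_t tb.
exists t; split=> //.
  rewrite in_itv/= a_t lt_neqAle tb andbT/=; apply/eqP => tb'.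
  by move: gtNy; rewrite tb' ltNge ygb.
move=> s /andP[ts sb]; rewrite ltNge; apply/negP => gsy.
have : s <= t.
  apply: ub_le_sup; first by exists b.
  by split=> //; rewrite in_itv/= sb (le_trans a_t (ltW ts)).
by rewrite leNgt ts.
Unshelve. all: by end_near. Qed.

Lemma local_g_equicontinuity (R : realType) (K : numFieldType)
    (a b : R) (g : R -> R) (F : set (R -> K)) (e : K) (y : R) :
  a < b -> {homo g : x y / x <= y} ->
  (forall t : R, g s @[s --> t^'-] --> g t) ->
  g_equicontinuous a b g F ->
  (forall t : R, t \in `[a, b[ -> discontinuities g t ->
    uniform_right_limit F t) ->
  0 < e -> y \in `[g a, g b] ->
  exists2 d : R, 0 < d & forall (f : R -> K) (s u : R), F f ->
    s \in `[a, b] -> u \in `[a, b] -> `|y - g s| < d -> `|y - g u| < d ->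
    `|f s - f u| < e.
Proof.
move=> ab ndg lcg ecF limF e0 yg.
have e20 : 0 < e / 2 by rewrite divr_gt0.
have [[t tab <-]|gNy] := pselect (exists2 t, t \in `[a, b] & g t = y).
  have [d d0 dF] := ecF _ t e20 tab; exists d => // f s u Ff sab uab ts tu.
  rewrite [e]splitr.
  apply: le_lt_trans (ltrD (dF f s Ff sab ts) (dF f u Ff uab tu)).
  by rewrite (distrC (f t)) ler_distD.
have [|t [tab gty ygs]] := skipped_value_jump _ a b g y ab ndg lcg yg.
  by move=> t tab; apply/eqP => gty; apply: gNy; exists t.
have /andP[at_ tb] : a <= t < b by move: tab; rewrite in_itv.
(* To the right of [t], [g] exceeds [y], so its right limit is at least [y], hence above [g t]. *)
have tD : discontinuities g t.
  rewrite /discontinuities/= subr_gt0; apply: (lt_le_trans gty).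
  apply: limr_ge; first exact: monotone_right_cvg.
  near=> s; apply/ltW/ygs/andP; split; near: s; first exact: nbhs_right_gt.
  exact: nbhs_right_le.
have [r /= r0 rF] := limF t tab tD _ e20.
(* Capping at [b] keeps [v] in the range where [g] is known to exceed [y]. *)
pose v := Num.min b (t + r).
have tv : t < v by rewrite lt_min tb ltrDl.
have vb : v <= b by rewrite ge_min lexx.
have ygv : y < g v by rewrite ygs// tv.
have vF s f : t < s < v -> F f -> `|f s - lim (f u @[u --> t^'+])| < e / 2.
  rewrite lt_min => /and3P[ts sb str] Ff; apply: rF => //=.
  by rewrite ltr_distlC; apply/andP; split; lra.
(* With this [d], a value [g s] within [d] of [y] lies strictly between [g t] and [g v], and
   monotonicity then forces [t < s < v]. *)
pose d := Num.min (y - g t) (g v - y).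
have limd s f : F f -> s \in `[a, b] -> `|y - g s| < d ->
    `|f s - lim (f u @[u --> t^'+])| < e / 2.
  move=> Ff sab; rewrite lt_min !ltr_distlC => /andP[/andP[ys _] /andP[_ sv]].
  apply: vF => //; apply/andP; split.
    rewrite ltNge; apply/negP => /ndg; lra.
  rewrite ltNge; apply/negP => /ndg; lra.
exists d; first by rewrite lt_min !subr_gt0 gty.
move=> f s u Ff sab uab ys yu.
rewrite [e]splitr.
apply: le_lt_trans (ltrD (limd s f Ff sab ys) (limd u f Ff uab yu)).
by rewrite (distrC (f u)) ler_distD.
Unshelve. all: by end_near. Qed.

Lemma right_limit_uniformly_g_equicontinuous (R : realType) (K : numFieldType)
    (a b : R) (g : R -> R) (F : set (R -> K)) :
  a < b -> {homo g : x y / x <= y} ->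
  (forall t : R, g s @[s --> t^'-] --> g t) ->
  g_equicontinuous a b g F ->
  (forall t : R, t \in `[a, b[ -> discontinuities g t ->
    uniform_right_limit F t) ->
  uniformly_g_equicontinuous a b g F.
Proof.
move=> ab ndg lcg ecF limF e e0.
pose P (d y : R) := forall (f : R -> K) (s u : R), F f ->
  s \in `[a, b] -> u \in `[a, b] -> `|y - g s| < d -> `|y - g u| < d ->
  `|f s - f u| < e.
have : \forall d \near 0^'+, `[g a, g b] `<=` P d.
  (* Compactness as near-covering: it suffices that [P c z] holds for [z] near each [y] and small
     [c > 0]. Halving the local radius [d] at [y] leaves room to move the centre from [y] to [z]. *)
  apply: (compact_near_coveringP _).1 (@segment_compact _ _ _) _ _ _ _ _.
  move=> y yg.
  have [d d0 dF] :=
    local_g_equicontinuity _ _ a b g F e y ab ndg lcg ecF limF e0 yg.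
  have d20 : 0 < d / 2 by rewrite divr_gt0.
  near=> z c => f s u Ff sab uab zs zu.
  have yz : `|y - z| < d / 2.
    by near: z; apply: cvgr_dist_lt => //; exact: cvg_id.
  have cd : c < d / 2 by near: c; exact: nbhs_right_lt.
  have close r : `|z - g r| < c -> `|y - g r| < d.
    move=> zr; rewrite [d]splitr; apply: le_lt_trans (ltrD yz (lt_trans zr cd)).
    exact: ler_distD.
  by apply: dF => //; exact: close.
move=> gP; have : \forall d \near 0^'+, 0 < d /\ `[g a, g b] `<=` P d.
  by apply: filterI gP; exact: nbhs_right_gt.
move=> /(@filter_ex _ _ (at_right_proper_filter _)) [d [d0 dP]].
exists d => // f s t Ff sab tab ts.
(* The ball is centred at [g t], so the point [t] is trivially within [d]. *)
apply: (dP (g t)) => //; last by rewrite subrr normr0.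
rewrite /= in_itv/=; move: tab; rewrite in_itv/= => /andP[at_ tb].
by rewrite !ndg.
Unshelve. all: by end_near. Qed.

Theorem proposition3p7 (R : realType) (k : scalars) (a b : R) (g : R -> R)
    (F : set (R -> scalar_field R k)) :
  a < b ->
  {homo g : x y / x <= y} ->
  (forall t : R, g s @[s --> t^'-] --> g t) ->
  F `<=` @BC R (scalar_field R k) a b g ->
  g_equicontinuous a b g F ->
  uniformly_g_equicontinuous a b g F <->
  (forall t : R, t \in `[a, b[ -> discontinuities g t ->
     (forall f : R -> scalar_field R k, F f -> cvg (f s @[s --> t^'+])) /\
     uniform_right_limit F t).
Proof.
move=> ab ndg lcg _ ecF; split=> [ucF t tab _|limF].
  exact: uniformly_g_equicontinuous_right_limit tab ucF.
apply: right_limit_uniformly_g_equicontinuous => // t tab tD.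
by have [] := limF t tab tD.
Qed.
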